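(* Let $k$ be an algebraically closed field of characteristic zero, and let $\varphi_{0,1}\colon PSL_2(\mathbf{F}_7)\to PGL_4(k)$ be the faithful representation defined in the context. The (unique) nonsingular eigenspace of $\varphi_{0,1}(PSL_2(\mathbf{F}_7))$ in $\mathrm{Form}_{4,4}$ is $\langle x^3y+y^3z+z^3x,\ t^4\rangle$. Any quartic form $a(x^3y+y^3z+z^3x)+bt^4$ with $a,b\in k$, $ab\neq0$, is projectively equivalent to $x^3y+y^3z+z^3x+t^4$.
   Context: $\mathrm{Form}_{n,d}$ is the space of homogeneous polynomials of degree $d$ in $n$ variables over $k$ (variables $x,y,z,t$ when $n=4$). For $A\in GL_n(k)$, $f_{A^{-1}}$ denotes the form $v\mapsto f(Av)$, and $(A)$ is the class of $A$ in $PGL_n(k)$. A form $f\ne0$ is nonsingular if $V_p(f)\subset\mathbf{P}^{n-1}(k)$ is nonsingular. Forms $f,g$ are projectively equivalent if $f_{T^{-1}}=cg$ for some $T\in GL_n(k)$, $c\in k^*$. Eigenspaces: for a finite subgroup $G\subset PGL_n(k)$, a generating section is a finite set $\{A_1,\dots,A_m\}\subset GL_n(k)$ with $G=\langle (A_1),\dots,(A_m)\rangle$ and $\mathrm{ord}((A_i))=\mathrm{ord}(A_i)=d_i<\infty$. For $\rho=[\rho_1,\dots,\rho_m]$ with $\rho_i\in k^*$, $\rho_i^{d_i}=1$, consider $\{f\in\mathrm{Form}_{n,d}: f_{A_i^{-1}}=\rho_i f\ (1\le i\le m)\}$. When this space is nonzero it is called an eigenspace of $G$ in $\mathrm{Form}_{n,d}$,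 and when it contains a nonsingular form it is called a nonsingular eigenspace. The collection of (nonsingular) eigenspaces does not depend on the generating section. Definition of $\varphi_{0,1}$: $PSL_2(\mathbf{F}_7)$ is generated by the classes $(a),(b),(c)$ of $a=\begin{bmatrix}1&1\\0&1\end{bmatrix}$, $b=\begin{bmatrix}5&0\\0&3\end{bmatrix}$, $c=\begin{bmatrix}0&-1\\1&0\end{bmatrix}$. Let $\varepsilon\in k^*$ have order $7$ and $\delta=-\varepsilon-\varepsilon^2-\varepsilon^4+\varepsilon^3+\varepsilon^5+\varepsilon^6$ (so $\delta^2=-7$). $\varphi_{0,1}$ is the faithful representation with $(a)\mapsto(\mathrm{diag}[\varepsilon^4,\varepsilon^2,\varepsilon,1])$, $(b)\mapsto([e_3,e_1,e_2,e_4])$ (columns of the unit matrix), and $$(c)\mapsto\left(\begin{bmatrix}\varepsilon-\varepsilon^6&\varepsilon^2-\varepsilon^5&\varepsilon^4-\varepsilon^3&0\\\varepsilon^2-\varepsilon^5&\varepsilon^4-\varepsilon^3&\varepsilon-\varepsilon^6&0\\\varepsilon^4-\varepsilon^3&\varepsilon-\varepsilon^6&\varepsilon^2-\varepsilon^5&0\\0&0&0&\delta\end{bmatrix}\right).$$ *)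

(* Defs.v *)
From HB Require Import structures.
From mathcomp Require Import all_boot all_order all_algebra all_fingroup all_solvable.
From mathcomp Require Import mpoly.

Set Implicit Arguments.
Unset Strict Implicit.
Unset Printing Implicit Defensive.

(* repr below is the representative of a quotient class. *)
Import generic_quotient GRing.Theory.

Local Open Scope ring_scope.
Local Open Scope quotient_scope.

Definition mx_of_rows (R : nzRingType) (n : nat) (s : seq (seq R)) : 'M[R]_n :=
  \matrix_(i, j) nth 0 (nth [::] s i) j.

(* The library's {'GL_n[R]} is only available for finite R. *)
Record GL (k : fieldType) (n : nat) :=
  MkGL { GL_mx :> 'M[k]_n; _ : GL_mx \in unitmx }.

HB.instance Definition _ k n := [isSub for @GL_mx k n].
HB.instance Definition _ k n := [Choice of GL k n by <:].

Section GLGroup.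
Variables (k : fieldType) (n : nat).
Implicit Types A B C : GL k n.

Lemma GL_mxP A : GL_mx A \in unitmx. Proof. exact: valP. Qed.

Fact GL_mul_subproof A B : GL_mx A *m GL_mx B \in unitmx.
Proof. by rewrite unitmx_mul !GL_mxP. Qed.

Fact GL_inv_subproof A : invmx (GL_mx A) \in unitmx.
Proof. by rewrite unitmx_inv GL_mxP. Qed.

Definition GL_one : GL k n := MkGL (unitmx1 k n).
Definition GL_mul A B : GL k n := MkGL (GL_mul_subproof A B).
Definition GL_inv A : GL k n := MkGL (GL_inv_subproof A).

Fact GL_mulA : associative GL_mul.
Proof. by move=> A B C; apply/val_inj; rewrite /= mulmxA. Qed.
Fact GL_mul1 : left_id GL_one GL_mul.
Proof. by move=> A; apply/val_inj; rewrite /= mul1mx. Qed.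
Fact GL_mulr1 : right_id GL_one GL_mul.
Proof. by move=> A; apply/val_inj; rewrite /= mulmx1. Qed.
Fact GL_mulV : left_inverse GL_one GL_inv GL_mul.
Proof. by move=> A; apply/val_inj; rewrite /= mulVmx ?GL_mxP. Qed.
Fact GL_mulrV : right_inverse GL_one GL_inv GL_mul.
Proof. by move=> A; apply/val_inj; rewrite /= mulmxV ?GL_mxP. Qed.

HB.instance Definition _ :=
  isGroup.Build (GL k n) GL_mulA GL_mul1 GL_mulr1 GL_mulV GL_mulrV.

Definition projeq A B : bool := is_scalar_mx (GL_mx A *m invmx (GL_mx B)).

Lemma projeqP A B :
  reflect (exists2 c : k, c != 0 & GL_mx A = c *: GL_mx B) (projeq A B).
Proof.
apply: (iffP (is_scalar_mxP)) => [[c AB]|[c _ AB]]; last first.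
  by exists c; rewrite AB -scalemxAl mulmxV ?GL_mxP // scalemx1.
have {}AB : GL_mx A = c *: GL_mx B.
  by rewrite -mul_scalar_mx -AB mulmxKV ?GL_mxP.
have [c0|c0] := eqVneq c 0; last by exists c.
exists 1; rewrite ?oner_neq0 // scale1r.
have := GL_mxP A; rewrite AB c0 scale0r => u0.
have e1 : (1%:M : 'M[k]_n) = 0 by rewrite -(mulmxV u0) mul0mx.
by rewrite -[GL_mx B]mulmx1 e1 mulmx0.
Qed.

Fact projeq_refl : reflexive projeq.
Proof. by move=> A; apply/projeqP; exists 1; rewrite ?oner_neq0 ?scale1r. Qed.

Fact projeq_symW A B : projeq A B -> projeq B A.
Proof.
case/projeqP=> c c0 e; apply/projeqP; exists c^-1; first by rewrite invr_neq0.
by rewrite e scalerA mulVf ?scale1r.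
Qed.

Fact projeq_sym : ssrbool.symmetric projeq.
Proof. by move=> A B; apply/idP/idP; apply: projeq_symW. Qed.

Fact projeq_trans : transitive projeq.
Proof.
move=> B A C /projeqP[c c0 e1] /projeqP[d d0 e2]; apply/projeqP.
by exists (c * d); rewrite ?mulf_neq0 // e1 e2 scalerA.
Qed.

Canonical projeq_equiv := EquivRel projeq projeq_refl projeq_sym projeq_trans.

Definition PGL := {eq_quot projeq}.
HB.instance Definition _ := EqQuotient.on PGL.
HB.instance Definition _ := Choice.on PGL.

Definition pclass A : PGL := \pi_PGL A.

Lemma pclassP A B :
  (pclass A = pclass B) <->
  (exists2 c : k, c != 0 & GL_mx A = c *: GL_mx B).
Proof.
rewrite /pclass; split=> [AB|/projeqP AB]; first exact/projeqP/(@eqquotP _ _ PGL).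
exact/(@eqquotP _ _ PGL).
Qed.

Definition PGL_one : PGL := pclass GL_one.
Definition PGL_mul (x y : PGL) : PGL := pclass (GL_mul (repr x) (repr y)).
Definition PGL_inv (x : PGL) : PGL := pclass (GL_inv (repr x)).

Lemma pclass_repr x : pclass (repr x) = x. Proof. exact: reprK. Qed.

Lemma PGL_mulE A B : PGL_mul (pclass A) (pclass B) = pclass (GL_mul A B).
Proof.
have /pclassP[c c0 eA] := pclass_repr (pclass A).
have /pclassP[d d0 eB] := pclass_repr (pclass B).
apply/pclassP; exists (c * d); first by rewrite mulf_neq0.
by rewrite /= eA eB -scalemxAl -scalemxAr scalerA.
Qed.

Fact PGL_mulA : associative PGL_mul.
Proof.
move=> x y z; rewrite -(pclass_repr x) -(pclass_repr y) -(pclass_repr z).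
by rewrite !PGL_mulE GL_mulA.
Qed.
Fact PGL_mul1 : left_id PGL_one PGL_mul.
Proof. by move=> x; rewrite -(pclass_repr x) PGL_mulE GL_mul1. Qed.
Fact PGL_mulr1 : right_id PGL_one PGL_mul.
Proof. by move=> x; rewrite -(pclass_repr x) PGL_mulE GL_mulr1. Qed.
Fact PGL_mulV : left_inverse PGL_one PGL_inv PGL_mul.
Proof. by move=> x; rewrite -{2}(pclass_repr x) PGL_mulE GL_mulV. Qed.
Fact PGL_mulrV : right_inverse PGL_one PGL_inv PGL_mul.
Proof. by move=> x; rewrite -{1}(pclass_repr x) PGL_mulE GL_mulrV. Qed.

HB.instance Definition _ :=
  isGroup.Build PGL PGL_mulA PGL_mul1 PGL_mulr1 PGL_mulV PGL_mulrV.

Lemma pclassM A B : pclass (A * B)%g = (pclass A * pclass B)%g.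
Proof. by rewrite -[RHS]/(PGL_mul _ _) PGL_mulE. Qed.

End GLGroup.

Definition is_subgroup (gT : groupType) (H : gT -> Prop) : Prop :=
  [/\ H 1%g, forall x y, H x -> H y -> H (x * y)%g & forall x, H x -> H x^-1%g].

Definition generated (gT : groupType) (S : gT -> Prop) (x : gT) : Prop :=
  forall H : gT -> Prop, is_subgroup H -> (forall y, S y -> H y) -> H x.

Definition has_order (gT : groupType) (x : gT) (d : nat) : Prop :=
  (0 < d)%N /\ forall m, (x ^+ m)%g = 1%g <-> (d %| m)%N.

Notation Form k n d := (dhomog n k d) (only parsing).

(* f_{A^-1}, that is, the form v |-> f (A v) for column vectors v. *)
Definition form_act (k : fieldType) (n : nat) (f : {mpoly k[n]}) (A : 'M[k]_n)
  : {mpoly k[n]} :=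
  f \mPo [tuple \sum_(j < n) A i j *: 'X_j | i < n].

(* Jacobian criterion; points of projective space are represented by nonzero
   coordinate vectors. *)
Definition nonsingular (k : fieldType) (n : nat) (f : {mpoly k[n]}) : Prop :=
  f != 0 /\
  forall v : 'rV[k]_n, v != 0 -> f.@[v 0] = 0 -> exists i, (f^`M(i)).@[v 0] != 0.

Definition proj_equivalent (k : fieldType) (n : nat) (f g : {mpoly k[n]})
  : Prop :=
  exists (T : GL k n) (c : k), c != 0 /\ form_act f T = c *: g.

(* A finite subgroup G of PGL_n(k) is given by the list of its elements. *)

Definition generating_section (k : fieldType) (n : nat) (G : seq (PGL k n))
    (m : nat) (A : 'I_m -> GL k n) (d : 'I_m -> nat) : Prop :=
  (forall x, x \in G <-> generated (fun y => exists i, y = pclass (A i)) x) /\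
  (forall i, has_order (pclass (A i)) (d i) /\ has_order (A i) (d i)).

Definition eigenspace_of (k : fieldType) (n d : nat) (G : seq (PGL k n.+1))
    (E : {vspace Form k n.+1 d}) : Prop :=
  exists m (A : 'I_m -> GL k n.+1) (e : 'I_m -> nat) (rho : 'I_m -> k),
  [/\ generating_section G A e,
      forall i, rho i ^+ e i = 1,
      forall f : Form k n.+1 d,
        f \in E <-> forall i, form_act f (A i) = rho i *: (f : {mpoly k[n.+1]})
    & E != 0%VS].

Definition nonsingular_eigenspace (k : fieldType) (n d : nat)
    (G : seq (PGL k n.+1)) (E : {vspace Form k n.+1 d}) : Prop :=
  eigenspace_of G E /\
  exists2 f : Form k n.+1 d, f \in E & nonsingular f.

Section PSL.
Variables (n : nat) (R : finComUnitRingType).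
Local Open Scope group_scope.

Definition SL_set : {set {'GL_n[R]}} := [set g | \det (GLval g) == 1%R].

Fact SL_group_set : group_set SL_set.
Proof.
apply/group_setP; split=> [|x y]; first by rewrite inE GL_1E det1.
by rewrite !inE GL_MxE det_mulmx => /eqP-> /eqP->; rewrite mulr1.
Qed.

Canonical SL_group := Group SL_group_set.
End PSL.

Definition PSL (n : nat) (R : finComUnitRingType) :
    {group coset_of 'Z(SL_group n R)%g} :=
  (SL_group n R / 'Z(SL_group n R)%g)%G.

Local Notation F7 := 'F_7.

Definition mx_a : 'M[F7]_2 := mx_of_rows 2 [:: [:: 1; 1]; [:: 0; 1]].
Definition mx_b : 'M[F7]_2 := mx_of_rows 2 [:: [:: 5; 0]; [:: 0; 3]].
Definition mx_c : 'M[F7]_2 := mx_of_rows 2 [:: [:: 0; -1]; [:: 1; 0]].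

Fact det22 (A : 'M[F7]_2) :
  \det A = A ord0 ord0 * A ord_max ord_max - A ord0 ord_max * A ord_max ord0.
Proof.
rewrite (expand_det_row _ ord0) !big_ord_recl big_ord0 addr0 /cofactor !det_mx11.
rewrite !mxE /= expr0 expr1 mul1r mulN1r mulrN.
by congr (_ * A _ _ - A _ _ * A _ _); apply/val_inj.
Qed.

Lemma mx_a_det : \det mx_a = 1.
Proof. by rewrite det22 !mxE; apply/val_inj. Qed.
Lemma mx_b_det : \det mx_b = 1.
Proof. by rewrite det22 !mxE; apply/val_inj. Qed.
Lemma mx_c_det : \det mx_c = 1.
Proof. by rewrite det22 !mxE; apply/val_inj. Qed.

Fact det1_unit (A : 'M[F7]_2) : \det A = 1 -> A \is a GRing.unit.
Proof. by move=> dA; change (A \in unitmx); rewrite unitmxE dA unitr1. Qed.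

Definition gl_a : {'GL_2(7)} := FinRing.unit 'M[F7]_2 (det1_unit mx_a_det).
Definition gl_b : {'GL_2(7)} := FinRing.unit 'M[F7]_2 (det1_unit mx_b_det).
Definition gl_c : {'GL_2(7)} := FinRing.unit 'M[F7]_2 (det1_unit mx_c_det).

Section Phi01.
Variable (k : fieldType).

Definition phi01_a (eps : k) : 'M[k]_4 :=
  mx_of_rows 4 [:: [:: eps ^+ 4; 0; 0; 0];
                   [:: 0; eps ^+ 2; 0; 0];
                   [:: 0; 0; eps; 0];
                   [:: 0; 0; 0; 1]].

(* The columns are e_3, e_1, e_2, e_4. *)
Definition phi01_b : 'M[k]_4 :=
  mx_of_rows 4 [:: [:: 0; 1; 0; 0];
                   [:: 0; 0; 1; 0];
                   [:: 1; 0; 0; 0];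
                   [:: 0; 0; 0; 1]].

Definition phi01_delta (eps : k) : k :=
  - eps - eps ^+ 2 - eps ^+ 4 + eps ^+ 3 + eps ^+ 5 + eps ^+ 6.

Definition phi01_c (eps : k) : 'M[k]_4 :=
  let u := eps - eps ^+ 6 in
  let v := eps ^+ 2 - eps ^+ 5 in
  let w := eps ^+ 4 - eps ^+ 3 in
  mx_of_rows 4 [:: [:: u; v; w; 0];
                   [:: v; w; u; 0];
                   [:: w; u; v; 0];
                   [:: 0; 0; 0; phi01_delta eps]].

Definition is_pclass (x : PGL k 4) (M : 'M[k]_4) : Prop :=
  exists2 A : GL k 4, GL_mx A = M & x = pclass A.

(* phi is the faithful representation phi_{0,1}; only its restriction to
   PSL 2 F_7 matters, and that is determined by the values on the generators. *)
Definition is_phi01 (eps : k) (phi : coset_of 'Z(SL_group 2 F7)%g -> PGL k 4)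
  : Prop :=
  [/\ {in PSL 2 F7 &, {morph phi : g h / (g * h)%g}},
      {in PSL 2 F7 &, injective phi},
      is_pclass (phi (coset _ gl_a)) (phi01_a eps),
      is_pclass (phi (coset _ gl_b)) phi01_b
    & is_pclass (phi (coset _ gl_c)) (phi01_c eps)].

Definition phi01_image (phi : coset_of 'Z(SL_group 2 F7)%g -> PGL k 4) :
    seq (PGL k 4) :=
  [seq phi g | g in PSL 2 F7].

End Phi01.

Section Quartics.
Variable (k : fieldType).

Local Notation x := ('X_(inord 0) : {mpoly k[4]}).
Local Notation y := ('X_(inord 1) : {mpoly k[4]}).
Local Notation z := ('X_(inord 2) : {mpoly k[4]}).
Local Notation t := ('X_(inord 3) : {mpoly k[4]}).

Definition klein_poly : {mpoly k[4]} := x ^+ 3 * y + y ^+ 3 * z + z ^+ 3 * x.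
Definition t4_poly : {mpoly k[4]} := t ^+ 4.

Fact var_homog (i : 'I_4) : ('X_i : {mpoly k[4]}) \is 1.-homog.
Proof. by rewrite dhomogX /= mdeg1. Qed.

Fact klein_homog : klein_poly \is 4.-homog.
Proof.
have h i j : ('X_i ^+ 3 * 'X_j : {mpoly k[4]}) \is 4.-homog.
  have h3 := dhomogMn 3 (var_homog i).
  exact: dhomogM h3 (var_homog j).
by apply: rpredD (h _ _); apply: rpredD (h _ _) (h _ _).
Qed.

Fact t4_homog : t4_poly \is 4.-homog.
Proof. exact: dhomogMn 4 (var_homog _). Qed.

Definition klein : Form k 4 4 := DHomog klein_homog.
Definition t4 : Form k 4 4 := DHomog t4_homog.

End Quartics.

(* Main.v *)
(* A form in an eigenspace E is a semi-invariant of every matrix over the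
   projective group G, with a multiplier common to all of E; hence E is cut out
   by its multipliers at the matrices [a], [b], [c] of phi_{0,1}, and conversely
   any form with the same multipliers there as one nonzero f in E lies in E.

   Let f in E be nonsingular. If f vanishes at e4 = (0:0:0:1), then some
   [t^3 x_i] with [i < 3] occurs in f; [b] permutes these three monomials
   cyclically, while they have different weights under [a], a contradiction.
   So [t^4] occurs in f, and evaluation at e4 forces the multipliers
   1, 1, delta^4. The quartic monomials of weight zero under [a] are x^3y, y^3z,
   z^3x, xyzt and t^4; [b] makes the first three coefficients equal and [c]
   excludes xyzt, as its image contains x^3t with nonzero coefficient. *)

Require Import Defs.
From HB Require Import structures.
From mathcomp Require Import all_boot all_order all_algebra all_fingroup all_solvable.
From mathcomp Require Import mpoly ring.

Set Implicit Arguments.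
Unset Strict Implicit.
Unset Printing Implicit Defensive.

Import GRing.Theory.
Local Open Scope ring_scope.

(** * Linear substitutions acting on forms, and common semi-invariants *)

Lemma meval_form_act (k : fieldType) n (f : {mpoly k[n]}) (A : 'M[k]_n) v :
  (form_act f A).@[v] = f.@[fun i => \sum_j A i j * v j].
Proof.
rewrite /form_act comp_mpoly_meval; apply: meval_eq => i.
rewrite tnth_mktuple raddf_sum /=; apply: eq_bigr => j _.
by rewrite mevalZ mevalXU.
Qed.

Lemma form_actD (k : fieldType) n (f g : {mpoly k[n]}) A :
  form_act (f + g) A = form_act f A + form_act g A.
Proof. exact: comp_mpolyD. Qed.

Lemma form_actZ (k : fieldType) n c (f : {mpoly k[n]}) A :
  form_act (c *: f) A = c *: form_act f A.
Proof. exact: comp_mpolyZ. Qed.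

Lemma form_act1 (k : fieldType) n (f : {mpoly k[n]}) : form_act f 1%:M = f.
Proof.
rewrite -[RHS]comp_mpoly_id /form_act; congr (_ \mPo _).
apply: eq_from_tnth => i; rewrite !tnth_mktuple (bigD1 i) //= mxE eqxx scale1r.
by rewrite big1 ?addr0 // => j ne_ji; rewrite mxE eq_sym (negPf ne_ji) scale0r.
Qed.

Lemma form_actM (k : fieldType) n (f : {mpoly k[n]}) A B :
  form_act f (A *m B) = form_act (form_act f A) B.
Proof.
rewrite /form_act [f \mPo [tuple \sum_j A i j *: 'X_j | i < n]]comp_mpolyEX.
rewrite [LHS]comp_mpolyEX !raddf_sum /=; apply: eq_bigr => m _.
rewrite comp_mpolyZ !comp_mpolyX rmorph_prod /=; congr (_ *: _).
apply: eq_bigr => i _; rewrite rmorphXn /=; congr (_ ^+ _).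
rewrite !tnth_mktuple raddf_sum /=.
under [RHS]eq_bigr => j _ do
  rewrite comp_mpolyZ comp_mpolyXU -tnth_nth tnth_mktuple scaler_sumr.
rewrite exchange_big /=; apply: eq_bigr => j _.
rewrite mxE scaler_suml; apply: eq_bigr => l _; by rewrite scalerA.
Qed.

(** Being a semi-invariant thus depends only on the class of the matrix in [PGL], while the
    multiplier changes by a [d]-th power. *)
Lemma form_act_scale (k : fieldType) n d (f : {mpoly k[n]}) c A :
  f \is d.-homog -> form_act f (c *: A) = c ^+ d *: form_act f A.
Proof.
move=> /dhomogP hf; rewrite /form_act !comp_mpolyEX scaler_sumr.
apply: eq_big_seq => m /hf <-; rewrite scalerA [c ^+ _ * _]mulrC -scalerA.
congr (_ *: _); rewrite !comp_mpolyX /= mdegE -prodrXr -scaler_prod.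
apply: eq_bigr => i _; rewrite !tnth_mktuple -exprZn scaler_sumr.
by congr (_ ^+ _); apply: eq_bigr => j _; rewrite mxE scalerA.
Qed.

Lemma mcoeff_form_act_diag (k : fieldType) n (f : {mpoly k[n]}) (d : 'rV[k]_n) m :
  (form_act f (diag_mx d))@_m = (\prod_i d 0 i ^+ m i) * f@_m.
Proof.
rewrite /form_act comp_mpolyEX [in RHS](mpolyE f) !raddf_sum /= mulr_sumr.
apply: eq_bigr => m' _; rewrite !mcoeffZ mulrCA; congr (_ * _).
have -> : 'X_[m'] \mPo [tuple \sum_j diag_mx d i j *: 'X_j | i < n]
    = (\prod_i d 0 i ^+ m' i) *: 'X_[m'].
  rewrite comp_mpolyX [in RHS]mpolyXE_id -scaler_prod.
  apply: eq_bigr => i _; rewrite -exprZn tnth_mktuple (bigD1 i) //= mxE eqxx.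
  rewrite big1 ?addr0 // => j ne_ji.
  by rewrite mxE eq_sym (negPf ne_ji) scale0r.
by rewrite mcoeffZ mcoeffX; case: eqP => [->|] //; rewrite !mulr0.
Qed.

(** The matrix [perm_mx s] substitutes ['X_(s i)] for ['X_i], so the action is the renaming of
    variables [msym]. *)
Lemma mcoeff_form_act_perm (k : fieldType) n (f : {mpoly k[n]}) (s : 'S_n) m :
  (form_act f (perm_mx s))@_m = f@_[multinom m (s i) | i < n].
Proof.
rewrite -mcoeff_sym; congr (_@_m).
rewrite /form_act /msym /comp_mpoly; apply: eq_bigr => m' _; congr (_ * _).
apply: mmap1_eq => i; rewrite tnth_mktuple (bigD1 (s i)) //= !mxE eqxx scale1r.
by rewrite big1 ?addr0 // => j ne; rewrite !mxE eq_sym (negPf ne) scale0r.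
Qed.

(** The multiplier is chosen before the form, so all of [S] shares it. Below, [S] is either a whole
    eigenspace or a pair of forms to be compared. *)
Definition common_semi_invariant (k : fieldType) n (S : {mpoly k[n]} -> Prop)
  (A : 'M[k]_n) := exists2 c, c != 0 & forall f, S f -> form_act f A = c *: f.

(** The classes with a representative scaling all of [S] by one nonzero constant form a subgroup
    containing [C]. Homogeneity carries this over to every representative of such a class. *)
Lemma common_semi_invariant_generated (k : fieldType) n d
    (S : {mpoly k[n]} -> Prop) (C : PGL k n -> Prop) (A : GL k n) :
  (forall f, S f -> f \is d.-homog) ->
  (forall y, C y -> exists2 B : GL k n, y = pclass B & common_semi_invariant S B) ->
  Defs.generated C (pclass A) -> common_semi_invariant S A.
Proof.
move=> homS hC genA.
pose H x := exists2 B : GL k n, x = pclass B & common_semi_invariant S B.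
have [B AB [c c0 hB]] : H (pclass A).
  apply: genA hC; split.
  - exists 1%g => //; exists 1; rewrite ?oner_neq0 // => f Sf.
    by rewrite scale1r form_act1.
  - move=> _ _ [B1 -> [c1 c10 h1]] [B2 -> [c2 c20 h2]].
    exists (B1 * B2)%g; first by rewrite pclassM.
    exists (c1 * c2); first by rewrite mulf_neq0.
    by move=> f Sf; rewrite form_actM h1 // form_actZ h2 // scalerA.
  - move=> _ [B -> [c c0 h]]; exists (B^-1)%g.
      apply: (mulgI (pclass B)); rewrite mulgV -pclassM mulgV; exact/esym.
    exists c^-1; first by rewrite invr_neq0.
    move=> f Sf; apply: (scalerI c0); rewrite scalerA mulfV // scale1r.
    rewrite -form_actZ -h // -form_actM.
    by rewrite mulmxV ?form_act1 ?GL_mxP.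
case/pclassP: AB => s s0 ->; exists (s ^+ d * c).
  by rewrite mulf_neq0 ?expf_neq0.
by move=> f Sf; rewrite (form_act_scale _ _ (homS f Sf)) hB // scalerA.
Qed.

(** * Generators of [SL_2(F_7)] and of the image of [phi] *)

Section SL2F7.
Local Open Scope group_scope.

Definition upper (x : 'F_7) : 'M['F_7]_2 := mx_of_rows 2 [:: [:: 1%R; x]; [:: 0%R; 1%R]].

Lemma mx2P (R : Type) (A B : 'M[R]_2) :
  A ord0 ord0 = B ord0 ord0 -> A ord0 ord_max = B ord0 ord_max ->
  A ord_max ord0 = B ord_max ord0 -> A ord_max ord_max = B ord_max ord_max -> A = B.
Proof.
move=> h1 h2 h3 h4; apply/matrixP => i j.
have ordP (l : 'I_2) : l = ord0 \/ l = ord_max.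
  by case: l => [[|[]]] // h; [left|right]; apply/val_inj.
by case: (ordP i) => ->; case: (ordP j) => ->.
Qed.

Lemma sum_ord2 (R : nmodType) (F : 'I_2 -> R) : (\sum_i F i = F ord0 + F ord_max)%R.
Proof. by rewrite !big_ord_recl big_ord0 addr0; congr (_ + F _)%R; apply/val_inj. Qed.

(* [c^-1 = c^3], and [c * u r * c^-1] is the lower unitriangular matrix with
   entry [- r]. *)
Lemma clear_below_diagonal (R : comNzRingType) (M : 'M[R]_2) :
  let c : 'M[R]_2 := mx_of_rows 2 [:: [:: 0; -1]; [:: 1; 0]]%R in
  let u x : 'M[R]_2 := mx_of_rows 2 [:: [:: 1; x]; [:: 0; 1]]%R in
  (M ord0 ord0 = 1 -> M ord_max ord_max - M ord0 ord_max * M ord_max ord0 = 1 ->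
  c *m (u (M ord_max ord0) *m (c *m (c *m (c *m M)))) = u (M ord0 ord_max))%R.
Proof.
move=> /= M00 /(canRL (subrK _)) M11; apply: mx2P; rewrite ?(mxE, sum_ord2) /= ?M00; ring: M11.
Qed.

Lemma upper_exp (n : nat) : (GLval (gl_a ^+ n) = upper n%:R)%R.
Proof.
elim: n => [|n IHn].
  by rewrite expg0 GL_1E; apply: mx2P; rewrite !mxE.
rewrite expgS GL_MxE IHn; apply: mx2P; rewrite !mxE sum_ord2 !mxE /=; ring.
Qed.

(** Row reduction: left multiplications by powers of [gl_a] and by [gl_c] bring every matrix of
    determinant 1 to an upper unitriangular one, which is a power of [gl_a]. Inverses cost nothing,
    since the group is finite. *)
Lemma SL2_ind (P : {'GL_2(7)} -> Prop) :
  P gl_a -> P gl_c -> (forall g h, P g -> P h -> P (g * h)) ->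
  forall g, g \in SL_group 2 'F_7 -> P g.
Proof.
move=> Pa Pc PM g.
have PX h n : P h -> P (h ^+ n.+1).
  by move=> Ph; elim: n => [|n IHn]; rewrite ?expg1 // expgS; apply: PM.
(* Closure under products gives only positive powers; [1] is reached as [h ^+ #[h]]. *)
have PX' h n : P h -> P (h ^+ n).
  move=> Ph; case: n => [|n]; last exact: PX.
  rewrite expg0 -(expg_order h); case: #[h] (order_gt0 h) => // m _; exact: PX.
have PV h : P h -> P h^-1.
  move=> Ph; rewrite invg_expg; exact: PX'.
have PVr h g' : P h -> P (h * g') -> P g'.
  by move=> /PV Ph' Phg; rewrite -(mulKg h g'); apply: PM.
have Pup (h : {'GL_2['F_7]}) x : GLval h = upper x -> P h.
  move=> hE; suff -> : h = gl_a ^+ (x : nat) by exact: PX'.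
  apply/val_inj; rewrite /= -/(GLval _) -/(GLval _) hE upper_exp.
  by congr upper; rewrite natr_Zp.
pose up (x : 'F_7) := gl_a ^+ (x : nat).
have upE x : GLval (up x) = upper x by rewrite upper_exp natr_Zp.
have Pu x : P (up x) by apply: Pup (upE x).
have cE : GLval gl_c = mx_c by [].
have step1 (h : {'GL_2['F_7]}) : \det (GLval h) = 1%R -> GLval h ord0 ord0 = 1%R -> P h.
  move=> dh h00.
  pose r := GLval h ord_max ord0.
  do 3!apply: (PVr gl_c) => //.
  apply: (PVr (up r)) => //; apply: (PVr gl_c) => //.
  apply: (Pup _ (GLval h ord0 ord_max)).
  rewrite det22 h00 mul1r in dh.
  by rewrite !GL_MxE upE cE (clear_below_diagonal h00 dh).
have step2 (h : {'GL_2['F_7]}) : \det (GLval h) = 1%R -> GLval h ord_max ord0 != 0%R -> P h.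
  move=> dh h10.
  (* Adding [x] times the second row to the first turns the top left entry into 1. *)
  pose x := ((1 - GLval h ord0 ord0) / GLval h ord_max ord0)%R.
  apply: (PVr (up x)) => //; apply: step1; rewrite GL_MxE.
    by rewrite det_mulmx dh upE det22 !mxE /= !mulr1 mulr0 subr0.
  by rewrite mxE sum_ord2 upE !mxE /= /x divfK // mul1r addrC subrK.
rewrite inE => /eqP dg.
have [g10|] := eqVneq (GLval g ord_max ord0) 0%R; last exact: step2.
(* Multiplying by [c] moves the top left entry to the bottom left; it is nonzero because the
   determinant is 1 and the old bottom left entry is 0. *)
apply: (PVr gl_c) => //; apply: step2; rewrite GL_MxE cE.
  by rewrite det_mulmx dg mulr1 mx_c_det.
rewrite mxE sum_ord2 !mxE /= mul1r mul0r addr0.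
by apply: contra_eq_neq dg => g00; rewrite det22 g00 g10 mul0r mulr0 subrr eq_sym oner_neq0.
Qed.
End SL2F7.

(** An element of the image comes from some [h] in [SL_2(F_7)], to which [SL2_ind] applies;
    conversely, the image of a morphism is a subgroup, and it contains the three classes. *)
Lemma phi01_image_generated (k : fieldType) (eps : k)
    (phi : coset_of 'Z(SL_group 2 'F_7)%g -> PGL k 4) :
  is_phi01 eps phi ->
  exists A B C : GL k 4,
  [/\ GL_mx A = phi01_a eps, GL_mx B = phi01_b k, GL_mx C = phi01_c eps &
      forall x, x \in phi01_image phi <->
         Defs.generated (fun y => [\/ y = pclass A, y = pclass B | y = pclass C]) x].
Proof.
case=> phiM _ [A AE phia] [B BE phib] [C CE phic]; exists A, B, C; split=> //.
have SLN : SL_group 2 'F_7 \subset 'N('Z(SL_group 2 'F_7))%g.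
  exact/char_norm/center_char.
have sla : gl_a \in SL_group 2 'F_7 by rewrite inE; apply/eqP/mx_a_det.
have slb : gl_b \in SL_group 2 'F_7 by rewrite inE; apply/eqP/mx_b_det.
have slc : gl_c \in SL_group 2 'F_7 by rewrite inE; apply/eqP/mx_c_det.
have imP x : x \in phi01_image phi <-> exists2 g, g \in PSL 2 'F_7 & x = phi g.
  split=> [/imageP[g] | [g]]; first by exists g.
  by move=> gPSL ->; apply: image_f.
have phi1 : phi 1%g = 1%g.
  by apply: (mulgI (phi 1%g)); rewrite -phiM ?group1 // !mulg1.
move=> x; split=> [/imP[g /morphimP[h hN hSL ->] ->] H Hsub Hgen | gen_x].
  case: (Hsub) => H1 HM HV.
  (* Membership is carried through the induction because [phi] is multiplicative only on [PSL]. *)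
  have: h \in SL_group 2 'F_7 /\ H (phi (coset _ h)).
    move: h hSL {hN}; apply: SL2_ind.
    - by split=> //; apply: Hgen; constructor 1.
    - by split=> //; apply: Hgen; constructor 3.
    - move=> g1 g2 [sl1 h1] [sl2 h2]; split; first exact: groupM.
      rewrite morphM ?(subsetP SLN) // phiM ?mem_quotient //; exact: HM.
  by case.
apply: (gen_x (fun x => x \in phi01_image phi)).
  split.
  - by apply/imP; exists 1%g; rewrite ?group1.
  - move=> _ _ /imP[g1 g1P ->] /imP[g2 g2P ->]; apply/imP.
    by exists (g1 * g2)%g; rewrite ?groupM ?phiM.
  - move=> _ /imP[g gP ->]; apply/imP; exists g^-1%g; first exact: groupVr.
    by apply: (mulgI (phi g)); rewrite mulgV -phiM ?groupVr // mulgV.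
by move=> y [] ->; rewrite -?phia -?phib -?phic; apply/image_f/mem_quotient.
Qed.

(** * Monomials and points in four variables *)

Lemma ord4P (i : 'I_4) :
  [\/ i = inord 0, i = inord 1, i = inord 2 | i = inord 3].
Proof.
case: i => [[|[|[|[|]]]]] // i_lt4; [constructor 1|constructor 2|constructor 3|constructor 4];
  by apply/val_inj; rewrite /= inordK.
Qed.

Lemma big_ord4 (R : Type) (idx : R) (op : Monoid.law idx) (F : 'I_4 -> R) :
  \big[op/idx]_i F i =
  op (op (op (F (inord 0)) (F (inord 1))) (F (inord 2))) (F (inord 3)).
Proof.
rewrite !big_ord_recl big_ord0 Monoid.mulm1 !Monoid.mulmA.
by congr (op (op (op (F _) (F _)) (F _)) (F _)); apply/val_inj; rewrite /= inordK.
Qed.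

Definition inord4E := (inordK (erefl : (0 < 4)%N), inordK (erefl : (1 < 4)%N),
  inordK (erefl : (2 < 4)%N), inordK (erefl : (3 < 4)%N)).

Definition pt4 (R : nzRingType) (a b c d : R) (i : 'I_4) : R :=
  nth 0 [:: a; b; c; d] i.

Definition mon4 (a b c d : nat) : 'X_{1..4} :=
  [multinom nth 0%N [:: a; b; c; d] i | i < 4].

Lemma mon4E (m : 'X_{1..4}) : m = mon4 (m (inord 0)) (m (inord 1)) (m (inord 2)) (m (inord 3)).
Proof.
apply/mnmP => i; rewrite mnmE; by case: (ord4P i) => ->; rewrite inordK.
Qed.

Lemma meval_mon4 (R : comNzRingType) (v : 'I_4 -> R) a b c d :
  ('X_[mon4 a b c d]).@[v] =
  v (inord 0) ^+ a * v (inord 1) ^+ b * v (inord 2) ^+ c * v (inord 3) ^+ d.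
Proof. by rewrite mevalX big_ord4 /= !mnmE !inord4E. Qed.

Lemma mon4_mpolyX (R : comNzRingType) a b c d :
  'X_[R, mon4 a b c d] =
  'X_(inord 0) ^+ a * 'X_(inord 1) ^+ b * 'X_(inord 2) ^+ c * 'X_(inord 3) ^+ d.
Proof. by rewrite mpolyXE_id big_ord4 /= !mnmE !inord4E. Qed.

Lemma mdeg_mon4 a b c d : mdeg (mon4 a b c d) = (a + b + c + d)%N.
Proof. by rewrite mdegE big_ord4 /= !mnmE !inord4E. Qed.

(** * Coefficients under [phi01_a] and [phi01_b]; evaluation at multiples of e4 *)

Section Phi.
Variables (k : fieldType) (eps : k).

(* The exponent of [eps] by which [phi01_a eps] scales the monomial [m]. *)
Definition weight (m : 'X_{1..4}) : nat :=
  (4 * m (inord 0) + 2 * m (inord 1) + m (inord 2))%N.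

Lemma phi01_a_diag :
  phi01_a eps = diag_mx (\row_i pt4 (eps ^+ 4) (eps ^+ 2) eps 1 i).
Proof.
apply/matrixP => i j; rewrite !mxE /pt4.
by case: (ord4P i) => ->; case: (ord4P j) => ->; rewrite -val_eqE /= !inord4E.
Qed.

Lemma mcoeff_form_act_phi01_a f m :
  (form_act f (phi01_a eps))@_m = eps ^+ weight m * f@_m.
Proof.
rewrite phi01_a_diag mcoeff_form_act_diag big_ord4 /= !mxE /pt4 !inord4E /=.
by rewrite -!exprM expr1n mulr1 -!exprD.
Qed.

Lemma phi01_a_semi_invariant f rho m :
  form_act f (phi01_a eps) = rho *: f -> f@_m != 0 -> rho = eps ^+ weight m.
Proof.
move=> fA fm; apply: (mulIf fm).
by rewrite -mcoeff_form_act_phi01_a fA mcoeffZ.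
Qed.

(** The list has three entries, so the index 3 gets the default [inord 3] and is fixed, while 0, 1,
    2 are cycled. *)
Lemma cycle3_subproof : injective
  (fun i : 'I_4 => nth (inord 3) [:: inord 1; inord 2; inord 0] i : 'I_4).
Proof.
move=> i j; case: (ord4P i) => ->; case: (ord4P j) => ->;
  by rewrite !inord4E //= => /(congr1 val); rewrite /= !inord4E.
Qed.
Definition cycle3 : 'S_4 := perm cycle3_subproof.

Lemma phi01_b_perm : phi01_b k = perm_mx cycle3.
Proof.
apply/matrixP => i j; rewrite !mxE permE -val_eqE.
by case: (ord4P i) => ->; case: (ord4P j) => ->; rewrite !inord4E /= ?inord4E.
Qed.

Lemma mcoeff_form_act_phi01_b (f : {mpoly k[4]}) a b c d :
  (form_act f (phi01_b k))@_(mon4 a b c d) = f@_(mon4 b c a d).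
Proof.
rewrite phi01_b_perm mcoeff_form_act_perm; congr (f@_ _); apply/mnmP => i.
by rewrite !mnmE permE; case: (ord4P i) => ->; rewrite ?inord4E /= ?inord4E.
Qed.

(** At such a point only powers of [t] survive, and the degree leaves only [t^d]. *)
Lemma meval_e4 (f : {mpoly k[4]}) d s : f \is d.-homog ->
  f.@[pt4 0 0 0 s] = f@_(mon4 0 0 0 d) * s ^+ d.
Proof.
move=> /dhomogP fhom; rewrite mevalE.
under eq_bigr => m _ do rewrite big_ord4 /= /pt4 !inord4E /=.
have [in_supp|] := boolP (mon4 0 0 0 d \in msupp f).
  rewrite (bigD1_seq (mon4 0 0 0 d)) //= big1_seq.
    by rewrite !mnmE !inord4E /= !expr0 !mul1r addr0.
  move=> m /andP[nm /fhom /= dm].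
  move: nm dm; rewrite (mon4E m) !mnmE !inord4E mdeg_mon4 /=.
  rewrite !expr0n; case: (m (inord 0)) => [|a]; last by rewrite /= ?(mul0r, mulr0).
  case: (m (inord 1)) => [|b]; last by rewrite /= ?(mul0r, mulr0).
  case: (m (inord 2)) => [|c]; last by rewrite /= ?(mul0r, mulr0).
  by rewrite !add0n => nm md; rewrite md eqxx in nm.
move=> nsupp; rewrite (memN_msupp_eq0 nsupp) mul0r big1_seq // => m /andP[_ sm].
move: (sm) (fhom _ sm) => /=; rewrite {1 2}(mon4E m) mdeg_mon4.
rewrite !expr0n; case: (m (inord 0)) => [|a]; last by rewrite /= ?(mul0r, mulr0).
case: (m (inord 1)) => [|b]; last by rewrite /= ?(mul0r, mulr0).
case: (m (inord 2)) => [|c]; last by rewrite /= ?(mul0r, mulr0).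
by rewrite !add0n => im md; rewrite md (negPf nsupp) in im.
Qed.

End Phi.

(** * Quartics with multipliers 1, 1, [delta ^+ 4] *)

Lemma mpolyE_seq n (R : nzRingType) (f : {mpoly R[n]}) (s : seq 'X_{1..n}) :
  uniq s -> {subset msupp f <= s} -> f = \sum_(m <- s) f@_m *: 'X_[m].
Proof.
move=> us sub; apply/mpolyP => m; rewrite raddf_sum /=.
under eq_bigr do rewrite mcoeffZ mcoeffX.
have [ms|ms] := boolP (m \in s).
  rewrite (bigD1_seq m) //= eqxx mulr1 big1 ?addr0 // => m' /negPf->.
  by rewrite mulr0.
rewrite big1_seq ?(memN_msupp_eq0 (contra (@sub m) ms)) // => m' /= m's.
by case: eqP m's => [->|_ _]; [rewrite (negPf ms) | rewrite mulr0].
Qed.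

Lemma weight_zero_monomials (m : 'X_{1..4}) :
  mdeg m = 4%N -> (7 %| weight m)%N ->
  m \in [:: mon4 3 1 0 0; mon4 0 3 1 0; mon4 1 0 3 0; mon4 1 1 1 1; mon4 0 0 0 4].
Proof.
rewrite /weight [in mdeg m](mon4E m) [in _ \in _](mon4E m) mdeg_mon4 !inE.
move: (m (inord 0)) (m (inord 1)) (m (inord 2)) (m (inord 3)) => a b c d.
move=> deg; have d_eq : d = (4 - (a + b + c))%N by rewrite -deg addKn.
have : (a + b + c <= 4)%N by rewrite -deg leq_addr.
rewrite {}d_eq {deg}.
(* The degree bounds [a], [b], [c] by 4; computing the weight modulo 7 settles each of the finitely
   many cases. *)
by move: a b c => [|[|[|[|[|a]]]]] [|[|[|[|[|b]]]]] [|[|[|[|[|c]]]]] // _ _;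
  rewrite eqxx ?orbT.
Qed.

Lemma eq_mon4 a b c d a' b' c' d' :
  (mon4 a b c d == mon4 a' b' c' d') = [&& a == a', b == b', c == c' & d == d'].
Proof.
apply/eqP/and4P => [/mnmP E | [/eqP-> /eqP-> /eqP-> /eqP->]] //.
have := (E (inord 0), E (inord 1), E (inord 2), E (inord 3)).
by rewrite !mnmE !inord4E /= => -[[[-> ->] ->] ->].
Qed.

(** A polynomial identity modulo the seventh cyclotomic polynomial. Stated over any commutative
    ring, it can be applied inside the polynomial ring, with [E] the constant polynomial [eps] and
    [x], [y], [z] the variables. *)
Lemma klein_identity (R : comNzRingType) (E x y z : R) :
  E ^+ 6 = - (1 + E + E ^+ 2 + E ^+ 3 + E ^+ 4 + E ^+ 5) ->
  let u := E - E ^+ 6 in let v := E ^+ 2 - E ^+ 5 in let w := E ^+ 4 - E ^+ 3 in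
  let X := u * x + v * y + w * z in let Y := v * x + w * y + u * z in
  let Z := w * x + u * y + v * z in
  X ^+ 3 * Y + Y ^+ 3 * Z + Z ^+ 3 * X =
  (- E - E ^+ 2 - E ^+ 4 + E ^+ 3 + E ^+ 5 + E ^+ 6) ^+ 4
  * (x ^+ 3 * y + y ^+ 3 * z + z ^+ 3 * x).
Proof. move=> E6 /=; ring: E6. Qed.

Section Phi.
Variables (k : fieldType) (eps : k).
Hypothesis prim_eps : 7.-primitive_root eps.

Let u := eps - eps ^+ 6.
Let v := eps ^+ 2 - eps ^+ 5.
Let w := eps ^+ 4 - eps ^+ 3.
Let delta := phi01_delta eps.

(** Cancel [eps - 1] in [eps ^+ 7 - 1 = 0]. By this relation [ring] reduces powers of [eps]
    below. *)
Lemma eps6 : eps ^+ 6 = - (1 + eps + eps ^+ 2 + eps ^+ 3 + eps ^+ 4 + eps ^+ 5).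
Proof.
have ne1 : eps - 1 != 0.
  by have := eq_prim_root_expr prim_eps 1 0; rewrite subr_eq0 expr1 => ->.
have e7 : eps ^+ 7 = 1 by exact: prim_expr_order.
apply: (mulfI ne1); ring: e7.
Qed.

Lemma eps_uvw_neq0 : [/\ u != 0, v != 0 & w != 0].
Proof.
have ne i j : (i < j < 7)%N -> eps ^+ i != eps ^+ j.
  case/andP=> ij j7; rewrite (eq_prim_root_expr prim_eps).
  by rewrite !modn_small ?(ltn_trans ij) // ltn_eqF.
by split; rewrite subr_eq0 ?[eps ^+ 4 == _]eq_sym ?ne // -{1}[eps]expr1 ne.
Qed.

(** The squares modulo 7 are 1, 2, 4, so [delta] is minus the quadratic Gauss sum modulo 7. *)
Lemma delta_sqr : delta ^+ 2 = - 7%:R.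
Proof. rewrite /delta /phi01_delta; ring: eps6. Qed.

(** A primitive seventh root of unity exists only where 7 is nonzero. *)
Lemma delta_neq0 : delta != 0.
Proof.
have := prim_root_natf_neq0 prim_eps; apply: contra_neq => d0.
by apply: oppr_inj; rewrite -delta_sqr d0 expr0n oppr0.
Qed.

Lemma klein_mon4 : klein_poly k = 'X_[mon4 3 1 0 0] + 'X_[mon4 0 3 1 0] + 'X_[mon4 1 0 3 0].
Proof. rewrite !mon4_mpolyX /klein_poly; ring. Qed.

Lemma t4_mon4 : t4_poly k = 'X_[mon4 0 0 0 4].
Proof. rewrite mon4_mpolyX /t4_poly; ring. Qed.

Lemma phi01_c_meval (x : 'I_4 -> k) i :
  \sum_j phi01_c eps i j * x j =
  pt4 (u * x (inord 0) + v * x (inord 1) + w * x (inord 2))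
      (v * x (inord 0) + w * x (inord 1) + u * x (inord 2))
      (w * x (inord 0) + u * x (inord 1) + v * x (inord 2))
      (delta * x (inord 3)) i.
Proof.
rewrite big_ord4 /= /pt4 !mxE !inord4E.
by case: (ord4P i) => ->; rewrite !inord4E /= ?mul0r ?addr0 ?add0r.
Qed.

Lemma phi01_b_meval (x : 'I_4 -> k) i :
  \sum_j phi01_b k i j * x j =
  pt4 (x (inord 1)) (x (inord 2)) (x (inord 0)) (x (inord 3)) i.
Proof.
rewrite big_ord4 /= /pt4 !mxE !inord4E.
by case: (ord4P i) => ->; rewrite !inord4E /= ?mul0r ?mul1r ?addr0 ?add0r.
Qed.

Lemma semi_invariants_klein_t4 (f : {mpoly k[4]}) :
  f \is 4.-homog -> form_act f (phi01_a eps) = f ->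
  form_act f (phi01_b k) = f -> form_act f (phi01_c eps) = delta ^+ 4 *: f ->
  exists a b, f = a *: klein_poly k + b *: t4_poly k.
Proof.
move=> /dhomogP fhom fA fB fC.
have /mpolyE_seq : {subset msupp f <=
    [:: mon4 3 1 0 0; mon4 0 3 1 0; mon4 1 0 3 0; mon4 1 1 1 1; mon4 0 0 0 4]}.
  move=> m supp_m; apply: weight_zero_monomials; first exact: fhom.
  rewrite mcoeff_msupp in supp_m.
  rewrite (prim_order_dvd prim_eps); apply/eqP/esym.
  by apply: (@phi01_a_semi_invariant _ eps f) supp_m; rewrite scale1r.
rewrite /= !inE !eq_mon4 /= !big_cons big_nil addr0 => /(_ isT).
move: (f@_(mon4 3 1 0 0)) (f@_(mon4 0 3 1 0)) (f@_(mon4 1 0 3 0)) => a a' a''.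
move: (f@_(mon4 1 1 1 1)) (f@_(mon4 0 0 0 4)) => c b fE.
have evalE x : f.@[x] = a * x (inord 0) ^+ 3 * x (inord 1)
    + a' * x (inord 1) ^+ 3 * x (inord 2) + a'' * x (inord 2) ^+ 3 * x (inord 0)
    + c * (x (inord 0) * x (inord 1) * x (inord 2) * x (inord 3))
    + b * x (inord 3) ^+ 4.
  by rewrite fE !mevalD !mevalZ !meval_mon4; ring.
have evalB x : f.@[pt4 (x (inord 1)) (x (inord 2)) (x (inord 0)) (x (inord 3))] = f.@[x].
  by rewrite -{2}fB meval_form_act; apply: meval_eq => i; rewrite phi01_b_meval.
(* At (0,1,1,0) and at its image (1,1,0,0) just one monomial each survives; the next step uses
   (1,1,0,0) and (1,0,1,0) in the same way. *)
have a'E : a' = a.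
  have := evalB (pt4 0 1 1 0); rewrite !evalE /pt4 !inord4E /= => E; ring: E.
have a''E : a'' = a.
  have := evalB (pt4 1 1 0 0); rewrite !evalE /pt4 !inord4E /= => E; ring: E.
have c0 : c = 0.
  (* The matrix of [c] sends (1,0,0,1) to (u,v,w,delta), the sum of its first and last columns. *)
  have : f.@[pt4 u v w delta] = delta ^+ 4 * f.@[pt4 1 0 0 1].
    rewrite -mevalZ -fC meval_form_act; apply: meval_eq => i.
    by rewrite phi01_c_meval /pt4 !inord4E /= !mulr0 !mulr1 !addr0.
  rewrite !evalE a'E a''E /pt4 !inord4E /= => E.
  have [u0 v0 w0] := eps_uvw_neq0.
  apply: (mulIf (mulf_neq0 (mulf_neq0 (mulf_neq0 u0 v0) w0) delta_neq0)).
  (* The point (u:v:w) lies on the Klein quartic, as the image of its point (1:0:0). The terms in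
     [a] and [b] therefore cancel, leaving [c * u * v * w * delta = 0]. *)
  have K : u ^+ 3 * v = - (v ^+ 3 * w + w ^+ 3 * u) by rewrite /u /v /w; ring: eps6.
  move/eqP: E; rewrite -subr_eq0 mul0r => /eqP <-.
  by move: K; move: u v w delta => U V W D K; ring: K.
exists a, b; rewrite fE a'E a''E c0 klein_mon4 t4_mon4 scale0r add0r.
by rewrite !scalerDr !addrA.
Qed.

Lemma klein_semi_invariant :
  [/\ form_act (klein_poly k) (phi01_a eps) = klein_poly k,
      form_act (klein_poly k) (phi01_b k) = klein_poly k &
      form_act (klein_poly k) (phi01_c eps) = delta ^+ 4 *: klein_poly k].
Proof.
split.
- apply/mpolyP => m; rewrite mcoeff_form_act_phi01_a klein_mon4 !mcoeffD !mcoeffX.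
  have wE a b c d : weight (mon4 a b c d) = (4 * a + 2 * b + c)%N.
    by rewrite /weight !mnmE !inord4E.
  have e0 j : (7 %| j)%N -> eps ^+ j = 1.
    by rewrite (prim_order_dvd prim_eps) => /eqP.
  (* The three monomials have weights 14, 7 and 7. *)
  case: eqP => [<-|_]; first by rewrite e0 ?mul1r // wE.
  case: eqP => [<-|_]; first by rewrite e0 ?mul1r // wE.
  case: eqP => [<-|_]; first by rewrite e0 ?mul1r // wE.
  by rewrite !addr0 mulr0.
- rewrite /form_act /klein_poly !(rmorphD, rmorphM, rmorphXn) /= !comp_mpolyXU.
  rewrite -!tnth_nth !tnth_mktuple !big_ord4 /= !mxE !inord4E /=.
  rewrite !scale0r ?scale1r !add0r ?addr0; ring.
- rewrite /form_act /klein_poly !(rmorphD, rmorphM, rmorphXn) /= !comp_mpolyXU.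
  rewrite -!tnth_nth !tnth_mktuple !big_ord4 /= !mxE !inord4E /= !scale0r !addr0 -!mul_mpolyC.
  rewrite /delta /phi01_delta !(rmorphD, rmorphB, rmorphN, rmorphXn) /=.
  apply: klein_identity; rewrite -rmorphXn /= eps6.
  by rewrite !(rmorphD, rmorphN, rmorphXn, rmorph1).
Qed.

Lemma t4_semi_invariant :
  [/\ form_act (t4_poly k) (phi01_a eps) = t4_poly k,
      form_act (t4_poly k) (phi01_b k) = t4_poly k &
      form_act (t4_poly k) (phi01_c eps) = delta ^+ 4 *: t4_poly k].
Proof.
split; rewrite /form_act /t4_poly rmorphXn /= comp_mpolyXU;
  rewrite -!tnth_nth !tnth_mktuple !big_ord4 /= !mxE !inord4E /=
   !scale0r ?scale1r !add0r //.
by rewrite exprZn.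
Qed.

End Phi.

(** * Nonsingularity of the Klein form plus [t^4] *)

Lemma nonsingular_klein_t4 (k : fieldType) : [pchar k] =i pred0 ->
  nonsingular (klein_poly k + t4_poly k).
Proof.
move=> char0; have nat_neq0 n : (n.+1%:R : k) != 0 by rewrite ((pcharf0P k).1 char0).
split.
  apply: contraTneq (oner_neq0 k) => f0; rewrite negbK.
  rewrite -(mcoeff0 k (mon4 0 0 0 4)) -f0 klein_mon4 t4_mon4 !mcoeffD !mcoeffX.
  by rewrite !eq_mon4 /= !add0r.
move=> x x_neq0 _; apply/existsP; apply: contraNT x_neq0.
rewrite negb_exists => /forallP /= dx.
have {}dx i : ((klein_poly k + t4_poly k)^`M(i)).@[x 0] = 0.
  by have := dx i; rewrite negbK => /eqP.
pose X := x 0 (inord 0); pose Y := x 0 (inord 1).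
pose Z := x 0 (inord 2); pose T := x 0 (inord 3).
have dE (i : 'I_4) : [:: 3%:R * X ^+ 2 * Y + Z ^+ 3; X ^+ 3 + 3%:R * Y ^+ 2 * Z;
    Y ^+ 3 + 3%:R * Z ^+ 2 * X; 4%:R * T ^+ 3]`_i = 0.
  rewrite -(dx i) klein_mon4 t4_mon4 !mderivD !mderivX !mevalD !mevalZ !mevalX.
  rewrite !big_ord4 /= !mnmBE !mnm1E !mnmE -!val_eqE /=.
  by case: (ord4P i) => ->; rewrite !inord4E /= /X /Y /Z /T; ring.
have := (dE (inord 0), dE (inord 1), dE (inord 2), dE (inord 3)).
rewrite !inord4E /= => -[[[dX dY] dZ] dT].
have T0 : T = 0.
  by move/eqP: dT; rewrite mulf_eq0 (negPf (nat_neq0 3)) expf_eq0 /= => /eqP.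
(* With [A = X^3 Y], [B = Y^3 Z], [C = Z^3 X] the partial derivatives give
   [3A + C = A + 3B = B + 3C = 0], hence [28A = 0]. *)
have A0 : X ^+ 3 * Y = 0.
  have /eqP : 28%:R * (X ^+ 3 * Y) = 0.
    transitivity (9%:R * X * (3%:R * X ^+ 2 * Y + Z ^+ 3)
      + Y * (X ^+ 3 + 3%:R * Y ^+ 2 * Z) - 3%:R * Z * (Y ^+ 3 + 3%:R * Z ^+ 2 * X)).
      ring.
    by rewrite dX dY dZ !mulr0 subr0 addr0.
  by rewrite mulf_eq0 (negPf (nat_neq0 27)) => /eqP.
(* Once [X] or [Y] vanishes, two of the partial derivatives reduce to cubes of the other two
   coordinates. *)
have XYZ : [/\ X = 0, Y = 0 & Z = 0].
  have cube0 (a : k) : a ^+ 3 = 0 -> a = 0 by move/eqP; rewrite expf_eq0 => /eqP.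
  move/eqP: A0; rewrite mulf_eq0 expf_eq0 /= => /orP[] /eqP xy0.
    move: dX dZ; rewrite xy0 !(mulr0, mul0r, expr0n) /= !(mulr0, mul0r, addr0, add0r).
    by move=> /cube0 Z0 /cube0 Y0.
  move: dX dY; rewrite xy0 !(mulr0, mul0r, expr0n) /= !(mulr0, mul0r, addr0, add0r).
  by move=> /cube0 Z0 /cube0 X0.
case: XYZ => X0 Y0 Z0; apply/eqP/rowP => i; rewrite mxE.
by case: (ord4P i) => ->.
Qed.

(** * Multipliers of a nonsingular semi-invariant *)

Section Phi.
Variables (k : fieldType) (eps : k).
Hypothesis prim_eps : 7.-primitive_root eps.
Let delta := phi01_delta eps.

Lemma semi_invariant_e4 (f : {mpoly k[4]}) rho_a rho_b :
  f \is 4.-homog -> nonsingular f -> form_act f (phi01_a eps) = rho_a *: f ->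
  rho_b != 0 -> form_act f (phi01_b k) = rho_b *: f ->
  f@_(mon4 0 0 0 4) != 0.
Proof.
move=> fhom [_ f_ns] fA rb0 fB; apply/eqP => f4.
pose e4 := \row_i pt4 (0 : k) 0 0 1 i.
have [||i] := f_ns e4.
- apply/eqP => /rowP /(_ (inord 3)) /eqP; by rewrite !mxE /pt4 inord4E /= oner_eq0.
- rewrite (@meval_eq _ _ _ (pt4 0 0 0 1)); last by move=> i; rewrite mxE.
  by rewrite (meval_e4 _ fhom) f4 mul0r.
rewrite mevalE.
(* A partial derivative nonzero at e4 has a term nonzero there, which must be a power of [t]. *)
case: (boolP (has (fun m : 'X_{1..4} => \prod_j e4 0 j ^+ m j != 0) (msupp f^`M(i)))).
  case/hasP=> m; rewrite mcoeff_msupp mcoeff_deriv => fm.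
  have {fm}: f@_(m + U_(i)) != 0 by apply: contraNneq fm => ->; rewrite mul0rn.
  rewrite (mon4E m) big_ord4 /= !mxE !mnmE /pt4 !inord4E /= !expr0n.
  case: (m (inord 0)) => [|?]; last by rewrite !mul0r eqxx.
  case: (m (inord 1)) => [|?]; last by rewrite !(mul0r, mulr0) eqxx.
  case: (m (inord 2)) => [|?]; last by rewrite !(mul0r, mulr0) eqxx.
  move: (m (inord 3)) => d fm _ _.
  have d3 : d = 3%N.
    have := dhomogP _ _ _ fhom _; rewrite -mcoeff_msupp in fm => /(_ _ fm) /=.
    by rewrite mdegD mdeg_mon4 mdeg1 addn1 => -[].
  have coB p q r s : f@_(mon4 q r p s) = rho_b * f@_(mon4 p q r s).
    by rewrite -mcoeffZ -fB mcoeff_form_act_phi01_b.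
  (* By the cyclic symmetry any one of [x t^3], [y t^3], [z t^3] brings in the others; the weights 4
     and 1 of the first and the last differ modulo 7. *)
  have [f1 f3] : f@_(mon4 1 0 0 3) != 0 /\ f@_(mon4 0 0 1 3) != 0.
    have U4 : (mon4 0 0 0 d + U_(i))%MM = mon4 (i == inord 0) (i == inord 1)
        (i == inord 2) (d + (i == inord 3)).
      apply/mnmP => j; rewrite mnmDE mnm1E !mnmE.
      by case: (ord4P i) => ->; case: (ord4P j) => ->; rewrite -!val_eqE /= !inord4E.
    move: fm; rewrite U4 d3 -!val_eqE /=.
    case: (ord4P i) => ->; rewrite !inord4E /= ?addn0.
    - by move=> f1; rewrite (coB 1 0 0 3)%N mulf_neq0.
    - by move=> f2; rewrite (coB 1 0 0 3)%N (coB 0 1 0 3)%N !mulf_neq0.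
    - by move=> f3; move: (f3); rewrite {1}(coB 1 0 0 3)%N mulf_eq0 negb_or => /andP[].
    - by rewrite f4 eqxx.
  have := phi01_a_semi_invariant fA f1; rewrite (phi01_a_semi_invariant fA f3).
  rewrite /weight !mnmE !inord4E /= => /eqP.
  by rewrite (eq_prim_root_expr prim_eps).
move/hasPn => e4m; rewrite big1_seq ?eqxx // => m /andP[_ /e4m].
by rewrite negbK => /eqP ->; rewrite mulr0.
Qed.

Lemma semi_invariant_character (f : {mpoly k[4]}) rho_a rho_b rho_c :
  f \is 4.-homog -> f@_(mon4 0 0 0 4) != 0 ->
  form_act f (phi01_a eps) = rho_a *: f ->
  form_act f (phi01_b k) = rho_b *: f ->
  form_act f (phi01_c eps) = rho_c *: f ->
  [/\ rho_a = 1, rho_b = 1 & rho_c = delta ^+ 4].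
Proof.
move=> fhom f4 fA fB fC; split.
- by rewrite (phi01_a_semi_invariant fA f4) /weight !mnmE !inord4E.
- apply: (mulIf f4).
  by rewrite -mcoeffZ -fB mcoeff_form_act_phi01_b mul1r.
(* The matrix of [c] sends e4 to [delta] times e4. *)
- have : f.@[pt4 0 0 0 delta] = rho_c * f.@[pt4 0 0 0 1].
    rewrite -mevalZ -fC meval_form_act; apply: meval_eq => i.
    by rewrite phi01_c_meval /pt4 !inord4E /= !mulr0 !mulr1 !addr0.
  rewrite !(meval_e4 _ fhom) expr1n mulr1 mulrC => fd.
  by apply/esym/(mulIf f4).
Qed.
End Phi.

(** * Projective equivalence of the quartics in the span *)

Lemma closed_root4 (k : closedFieldType) (c : k) : exists r, r ^+ 4 = c.
Proof.
have [r rE] := solve_monicpoly (fun i => if i == 0%N then c else 0) (isT : (0 < 4)%N).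
exists r; rewrite rE !big_ord_recl big_ord0 /= expr0 mulr1.
by rewrite !mul0r !addr0.
Qed.

Lemma klein_t4_spanP (k : fieldType) (g : Form k 4 4) :
  g \in (<[klein k]> + <[t4 k]>)%VS <->
  exists a b, g = a *: klein_poly k + b *: t4_poly k :> {mpoly k[4]}.
Proof.
split=> [/memv_addP[_ /vlineP[a ->] [_ /vlineP[b ->] ->]]|[a [b gE]]].
  by exists a, b.
have -> : g = a *: klein k + b *: t4 k by apply/val_inj; rewrite /= gE.
by rewrite memv_add ?memvZ ?memv_line.
Qed.

Lemma klein_t4_equivalent (k : closedFieldType) (a b : k) : a * b != 0 ->
  proj_equivalent (a *: klein_poly k + b *: t4_poly k) (klein_poly k + t4_poly k).
Proof.
rewrite mulf_eq0 negb_or => /andP[a0 b0].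
have [r rE] := closed_root4 a^-1; have [s sE] := closed_root4 b^-1.
(* Scaling [x], [y], [z] by [r] multiplies the Klein form by [r ^+ 4 = a^-1], and scaling [t] by [s]
   multiplies [t^4] by [s ^+ 4 = b^-1]. *)
pose D := diag_mx (\row_i pt4 r r r s i).
have D_unit : D \in unitmx.
  rewrite unitmxE det_diag big_ord4 /= !mxE /pt4 !inord4E /= unitfE.
  have r0 : r != 0 by apply: contra_neq (invr_neq0 a0) => r0; rewrite -rE r0 expr0n.
  have s0 : s != 0 by apply: contra_neq (invr_neq0 b0) => s0; rewrite -sE s0 expr0n.
  by rewrite !mulf_neq0.
exists (MkGL D_unit), 1; split; first exact: oner_neq0.
rewrite scale1r form_actD !form_actZ /=.
have -> : form_act (klein_poly k) D = a^-1 *: klein_poly k.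
  rewrite -rE /form_act /klein_poly !(rmorphD, rmorphM, rmorphXn) /= !comp_mpolyXU.
  rewrite -!tnth_nth !tnth_mktuple !big_ord4 /= !mxE -!val_eqE /pt4 /= !inord4E /=.
  rewrite ?mulr1n ?mulr0n !scale0r ?add0r ?addr0 -!mul_mpolyC rmorphXn /=; ring.
have -> : form_act (t4_poly k) D = b^-1 *: t4_poly k.
  rewrite -sE /form_act /t4_poly rmorphXn /= !comp_mpolyXU.
  rewrite -!tnth_nth !tnth_mktuple !big_ord4 /= !mxE -!val_eqE /pt4 /= !inord4E /=.
  by rewrite ?mulr1n ?mulr0n !scale0r ?add0r ?addr0 exprZn.
by rewrite !scalerA !mulfV // !scale1r.
Qed.

(** * Orders of the generating matrices and of their classes *)

Lemma has_prime_order (gT : groupType) (x : gT) p :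
  prime p -> (x ^+ p = 1 -> x <> 1 -> has_order x p)%g.
Proof.
move=> p_pr xp x1; split=> [|m]; first exact: prime_gt0.
split=> [xm|/dvdnP[q ->]]; last by rewrite mulnC expgM xp expg1n.
apply: contraT; rewrite -prime_coprime // coprime_sym => co_mp.
have m0 : (0 < m)%N by case: m co_mp {xm} => //; rewrite /coprime gcd0n => /eqP p1;
  rewrite p1 in p_pr.
(* Bezout: [km * m = kn * p + 1] turns [x ^+ m = x ^+ p = 1] into [x = 1]. *)
case: (egcdnP p m0) => km kn E _; case: x1.
have /= := congr1 (fun j => x ^+ j)%g E; rewrite (eqP co_mp) expgD expg1.
by rewrite [(km * _)%N]mulnC [(kn * _)%N]mulnC !expgM xm xp !expg1n mul1g => <-.
Qed.

Lemma generated_iff (gT : groupType) (C D : gT -> Prop) x :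
  (forall y, C y <-> D y) -> Defs.generated C x <-> Defs.generated D x.
Proof.
by move=> CD; split=> gen H Hsub HC; apply: gen Hsub _ => y /CD; apply: HC.
Qed.

Lemma GL_exp_diag (k : fieldType) n (A : GL k n) (d : 'rV[k]_n) m :
  GL_mx A = diag_mx d -> GL_mx (A ^+ m)%g = diag_mx (\row_i d 0 i ^+ m).
Proof.
move=> AE; elim: m => [|m IHm].
  rewrite expg0; apply/matrixP => i j; rewrite !mxE expr0.
  by case: eqP.
rewrite expgS -[LHS]/(GL_mx A *m GL_mx (A ^+ m)%g) IHm AE mulmx_diag.
by congr diag_mx; apply/rowP => i; rewrite !mxE exprS.
Qed.

Lemma pclass_eq1 (k : fieldType) n (A : GL k n) :
  pclass A = 1%g -> exists2 c : k, c != 0 & GL_mx A = c%:M.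
Proof.
by case/(pclassP A (GL_one k n)) => c c0 ->; exists c; rewrite // scalemx1.
Qed.

(** A nonscalar matrix has a nontrivial class, so primality of [p] fixes both orders at once. *)
Lemma has_order_pclass (k : fieldType) n (A : GL k n) p : prime p -> (A ^+ p = 1)%g ->
  (forall c, GL_mx A <> c%:M) -> has_order (pclass A) p /\ has_order A p.
Proof.
move=> p_pr Ap A_nscalar.
have A1 : pclass A <> 1%g by case/pclass_eq1 => c _; apply: A_nscalar.
have pX m : pclass (A ^+ m)%g = (pclass A ^+ m)%g.
  elim: m => [|m IHm]; first by rewrite !expg0.
  by rewrite !expgS pclassM IHm.
split; apply: has_prime_order => //; first by rewrite -pX Ap.
by move=> AE; apply: A1; rewrite AE.
Qed.

Lemma inord01 : (inord 0 == inord 1 :> 'I_4) = false.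
Proof. by rewrite -val_eqE /= !inord4E. Qed.

Section Phi.
Variables (k : fieldType) (eps : k).
Hypothesis prim_eps : 7.-primitive_root eps.
Let delta := phi01_delta eps.

Lemma phi01_a_order (A : GL k 4) : GL_mx A = phi01_a eps ->
  has_order (pclass A) 7 /\ has_order A 7.
Proof.
move=> AE; apply: has_order_pclass => // [|c].
  apply/val_inj; rewrite phi01_a_diag in AE.
  rewrite -[LHS]/(GL_mx (A ^+ 7)%g) (GL_exp_diag _ AE).
  have e7 j : (eps ^+ j) ^+ 7 = 1 by rewrite exprAC (prim_expr_order prim_eps) expr1n.
  apply/matrixP => i j; rewrite !mxE /pt4.
  by case: (ord4P i) => ->; rewrite inord4E /= ?e7 ?expr1n // (prim_expr_order prim_eps).
rewrite AE => /matrixP cE.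
have := cE (inord 2) (inord 2); have := cE (inord 3) (inord 3).
rewrite !mxE !eqxx !inord4E /= => <- /eqP.
by have := eq_prim_root_expr prim_eps 1 0; rewrite expr1 expr0 => ->.
Qed.

Lemma phi01_b_order (A : GL k 4) : GL_mx A = phi01_b k ->
  has_order (pclass A) 3 /\ has_order A 3.
Proof.
move=> AE; apply: has_order_pclass => // [|c].
  apply/val_inj; rewrite !expgS expg0 mulg1.
  rewrite -[LHS]/(GL_mx A *m (GL_mx A *m GL_mx A)) AE phi01_b_perm -!perm_mxM.
  rewrite -[RHS]/(1%:M) -perm_mx1; congr perm_mx; apply/permP => i.
  by rewrite !permM perm1 !permE; case: (ord4P i) => ->; rewrite ?inord4E /= ?inord4E /= ?inord4E.
rewrite AE => /matrixP /(_ (inord 0) (inord 1)) /eqP.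
by rewrite !mxE inord01 !inord4E /= mulr0n oner_eq0.
Qed.

(** Hence [delta^-1 *: phi01_c eps] is an involution, a representative whose order equals that of
    its class, as a generating section demands. *)
Lemma phi01_c_sqr : phi01_c eps *m phi01_c eps = (delta ^+ 2)%:M.
Proof.
rewrite (delta_sqr prim_eps); apply/matrixP => i j; rewrite mxE big_ord4 /= !mxE -[i == j]val_eqE.
case: (ord4P i) => ->; case: (ord4P j) => ->; rewrite /= !inord4E /= ?mulr1n ?mulr0n /phi01_delta;
  ring: (eps6 prim_eps).
Qed.

Lemma phi01_c_order (A : GL k 4) : GL_mx A = delta^-1 *: phi01_c eps ->
  has_order (pclass A) 2 /\ has_order A 2.
Proof.
have d0 := delta_neq0 prim_eps.
move=> AE; apply: has_order_pclass => // [|c].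
  apply/val_inj; rewrite !expgS expg0 mulg1.
  rewrite -[LHS]/(GL_mx A *m GL_mx A) AE -scalemxAl -scalemxAr phi01_c_sqr.
  by rewrite scalerA -expr2 exprVn scale_scalar_mx mulVf // expf_neq0.
rewrite AE => /matrixP /(_ (inord 0) (inord 1)) /eqP.
rewrite !mxE inord01 !inord4E /= mulr0n mulf_eq0 invr_eq0 (negPf d0) /=.
by have [_ /negPf-> _] := eps_uvw_neq0 prim_eps.
Qed.

Lemma span_semi_invariant a b (f := a *: klein_poly k + b *: t4_poly k) :
  [/\ form_act f (phi01_a eps) = f, form_act f (phi01_b k) = f
    & form_act f (phi01_c eps) = delta ^+ 4 *: f].
Proof.
have [ka kb kc] := klein_semi_invariant prim_eps.
have [ta tb tc] := t4_semi_invariant eps.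
split; rewrite form_actD !form_actZ ?ka ?kb ?kc ?ta ?tb ?tc //.
by rewrite /f [RHS]scalerDr !scalerA (mulrC a) (mulrC b).
Qed.

(** * The span as an eigenspace, and its uniqueness *)

Variable phi : coset_of 'Z(SL_group 2 'F_7)%g -> PGL k 4.
Hypothesis phi_def : is_phi01 eps phi.

(** For the generating section [A], [B], [delta^-1 *: C], of orders 7, 3, 2, all multipliers are 1:
    the rescaling of [C] absorbs [delta ^+ 4]. *)
Lemma span_eigenspace :
  eigenspace_of (phi01_image phi) (<[klein k]> + <[t4 k]>)%VS.
Proof.
have [A [B [C [AE BE CE genG]]]] := phi01_image_generated phi_def.
have d0 := delta_neq0 prim_eps.
have C'_unit : delta^-1 *: GL_mx C \in unitmx.
  by rewrite unitmxZ ?GL_mxP // unitfE invr_eq0.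
pose C' := MkGL C'_unit.
have CC' : pclass C' = pclass C.
  by apply/pclassP; exists delta^-1; rewrite ?invr_eq0.
exists 3%N, (tnth [tuple A; B; C']), (tnth [tuple 7; 3; 2]%N), (fun=> 1).
have ord3P (P : 'I_3 -> Prop) : (forall i, P i) <->
    [/\ P ord0, P (lift ord0 ord0) & P ord_max].
  split=> [// | [P0 P1 P2] [[|[|[|]]] //] i3]; [move: P0|move: P1|move: P2];
    by congr P; apply/val_inj.
split.
- split=> [x|].
    rewrite genG; apply: generated_iff => y; split.
      case=> ->; [exists ord0|exists (lift ord0 ord0)|exists ord_max].
      + reflexivity.
      + reflexivity.
      + exact/esym.
    case=> i ->; move: i; apply/ord3P; split.
    + by constructor 1.
    + by constructor 2.
    + by constructor 3; rewrite -CC'.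
  apply/ord3P; split; [exact: phi01_a_order|exact: phi01_b_order|].
  by apply: phi01_c_order; rewrite /= CE.
- by move=> i; rewrite expr1n.
- move=> f; rewrite klein_t4_spanP ord3P /= !scale1r.
  change (tnth [tuple A; B; C'] ord0) with A.
  change (tnth [tuple A; B; C'] (lift ord0 ord0)) with B.
  change (tnth [tuple A; B; C'] ord_max) with C'.
  have C'E : form_act f C' = delta ^- 4 *: form_act f C.
    by rewrite /= (form_act_scale _ _ (dhomog_is_dhomog f)) exprVn.
  rewrite C'E AE BE CE; split=> [[a [b ->]]|[fA fB fC]].
    have [-> -> ->] := span_semi_invariant a b.
    by rewrite scalerA mulVf ?scale1r // expf_neq0.
  apply: (semi_invariants_klein_t4 prim_eps (dhomog_is_dhomog f) fA fB).
  by rewrite -[X in _ = _ *: X]fC scalerA mulfV ?scale1r // expf_neq0.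
- apply/eqP => span0.
  have : klein k \in (<[klein k]> + <[t4 k]>)%VS.
    by apply/klein_t4_spanP; exists 1, 0; rewrite scale1r scale0r addr0.
  rewrite span0 memv0 => /eqP /(congr1 val) /= /eqP.
  apply/negP/eqP => /(congr1 (mcoeff (mon4 3 1 0 0))).
  rewrite klein_mon4 !mcoeffD !mcoeffX !eq_mon4 mcoeff0 /= !addr0 => /eqP.
  by rewrite oner_eq0.
Qed.

Lemma nonsingular_eigenspace_span (E : {vspace Form k 4 4}) :
  nonsingular_eigenspace (phi01_image phi) E ->
  E = (<[klein k]> + <[t4 k]>)%VS.
Proof.
case=> [[m [X [e [rho [[genX ordX] rhoX XE _]]]]] [f0 f0E f0_ns]].
have [A [B [C [AE BE CE genG]]]] := phi01_image_generated phi_def.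
have f0hom := dhomog_is_dhomog f0.
(* The section [X] defining [E] is arbitrary, so its multipliers are transported to the matrices of
   [a], [b], [c]. *)
have semiE Y : pclass Y \in phi01_image phi ->
    common_semi_invariant (fun f => exists2 g, g \in E & f = g :> {mpoly k[4]}) Y.
  move=> /genX; apply: common_semi_invariant_generated.
    by move=> _ [g _ ->]; apply: dhomog_is_dhomog.
  move=> _ [i ->]; exists (X i) => //; exists (rho i).
    have [_ [e_gt0 _]] := ordX i; apply: contraNneq (oner_neq0 k) => r0.
    by rewrite -(rhoX i) r0 expr0n eqn0Ngt e_gt0.
  by move=> _ [g /XE gE ->].
have inG Y : [\/ pclass Y = pclass A, pclass Y = pclass B | pclass Y = pclass C] ->
    pclass Y \in phi01_image phi.
  by move=> YE; apply/genG => H _; apply.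
have [] := semiE A; first by apply: inG; constructor 1.
rewrite AE => ra _ semiA.
have [] := semiE B; first by apply: inG; constructor 2.
rewrite BE => rb rb0 semiB.
have [] := semiE C; first by apply: inG; constructor 3.
rewrite CE => rc _ semiC.
have f0S : exists2 g, g \in E & (f0 : {mpoly k[4]}) = g by exists f0.
have f0e4 : (f0 : {mpoly k[4]})@_(mon4 0 0 0 4) != 0.
  exact: (semi_invariant_e4 prim_eps f0hom f0_ns (semiA _ f0S) rb0 (semiB _ f0S)).
have [] := semi_invariant_character f0hom f0e4 (semiA _ f0S) (semiB _ f0S) (semiC _ f0S).
move=> ra1 rb1 rcd; apply/vspaceP => g; apply/idP/idP => [gE | /klein_t4_spanP[a [b gE]]].
  have gS : exists2 h, h \in E & (g : {mpoly k[4]}) = h by exists g.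
  apply/klein_t4_spanP/(semi_invariants_klein_t4 prim_eps (dhomog_is_dhomog g)).
  - by rewrite (semiA _ gS) ra1 scale1r.
  - by rewrite (semiB _ gS) rb1 scale1r.
  - by rewrite (semiC _ gS) rcd.
have [gA gB gC] := span_semi_invariant a b; rewrite -gE in gA gB gC.
apply/XE => i.
(* Transport back to [X i]: [f0] and [g] share their multipliers at the three generators, hence at
   [X i]. Comparing [t^4] coefficients of [f0] identifies the shared multiplier as [rho i]. *)
have [|||c _ cE] := @common_semi_invariant_generated k 4 4
    (fun f => f = f0 \/ f = g) (fun y => [\/ y = pclass A, y = pclass B | y = pclass C]) (X i).
- by move=> _ [] ->; apply: dhomog_is_dhomog.
- have d4 : delta ^+ 4 != 0 by rewrite expf_neq0 // delta_neq0.
  move=> y [] ->; [exists A|exists B|exists C] => //.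
  + exists 1; rewrite ?oner_neq0 // AE => _ [] ->; last by rewrite gA scale1r.
    by rewrite (semiA _ f0S) ra1.
  + exists 1; rewrite ?oner_neq0 // BE => _ [] ->; last by rewrite gB scale1r.
    by rewrite (semiB _ f0S) rb1.
  + exists (delta ^+ 4); rewrite // CE => _ [] -> //.
    by rewrite (semiC _ f0S) rcd.
- by apply/genG/genX => H _; apply; exists i.
rewrite (cE _ (or_intror (erefl _))); congr (_ *: _).
apply: (mulIf f0e4); rewrite -!mcoeffZ -(cE _ (or_introl (erefl _))).
by have /XE/(_ i) -> := f0E.
Qed.

End Phi.

Theorem proposition4p8 (k : closedFieldType) (char0 : [pchar k] =i pred0)
    (eps : k) (eps_order7 : 7.-primitive_root eps)
    (phi : coset_of 'Z(SL_group 2 'F_7)%g -> PGL k 4)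
    (phi_def : is_phi01 eps phi) :
  (forall E : {vspace Form k 4 4},
     nonsingular_eigenspace (phi01_image phi) E
     <-> E = (<[klein k]> + <[t4 k]>)%VS)
  /\
  (forall a b : k, a * b != 0 ->
     proj_equivalent (a *: klein k + b *: t4 k : Form k 4 4)
                     (klein k + t4 k : Form k 4 4)).
Proof.
split=> [E | a b ab0]; last exact: klein_t4_equivalent.
split=> [|->]; first exact: (nonsingular_eigenspace_span eps_order7 phi_def).
split; first exact: (span_eigenspace eps_order7 phi_def).
exists (klein k + t4 k); last exact: nonsingular_klein_t4.
by rewrite memv_add ?memv_line.
Qed.
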